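(* Let $X$ be a reflexive real Banach space, $Y$ a real Banach space, $\Omega$ a measure space, $Z:=L^2(\Omega)$, and $e:Y\to Z$ a linear continuous dense embedding. Let $f:X\to\mathbb{R}$ and $g:X\to Y$ be continuously Fréchet differentiable, and assume $f$ and $x\mapsto\|g_+(x)\|_Z$ are weakly lower semicontinuous. Then every local solution $\bar x$ of the problem $\min f(x)$ s.t. $g(x)\le 0$ satisfies the AKKT conditions, i.e. there exist sequences $x^k\to\bar x$ in $X$ and $(\lambda^k)\subset K_Y^+$ such that $f'(x^k)+g'(x^k)^*\lambda^k\to 0$ in $X^*$ and $\langle\lambda^k,g_-(x^k)\rangle\to 0$.
   Context: The order on $Y$ is induced by $Z$: $K_Y:=\{y\in Y: e(y)\ge 0 \text{ a.e.}\}$ and $y\le 0$ means $-y\in K_Y$. $K_Y^+:=\{\mu\in Y^*:\langle\mu,y\rangle\ge 0\ \forall y\in K_Y\}$ is the dual cone, where $\langle\cdot,\cdot\rangle$ is the duality pairing between $Y^*$ and $Y$; $Z\cong Z^*$ is regarded as a subspace of $Y^*$ via $e^*$. For $z\in Z$, $z_+:=\max\{z,0\}$, $z_-:=\max\{-z,0\}$ pointwise, and $g_\pm(x):=(e(g(x)))_\pm$. *)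

(* Defs.v *)
From HB Require Import structures.
From mathcomp Require Import all_boot all_order all_algebra.
From mathcomp Require Import all_classical all_reals all_analysis.
Set Implicit Arguments. Unset Strict Implicit. Unset Printing Implicit Defensive.
Import Order.TTheory GRing.Theory Num.Theory.
Import numFieldNormedType.Exports.
Local Open Scope classical_set_scope.
Local Open Scope ring_scope.

Section Defs.
Context {R : realType}.

Definition lin_cont {V : normedModType R} (l : V -> R) : Prop :=
  (forall (a : R) (x y : V), l (a *: x + y) = a * l x + l y) /\ continuous l.

(* Reflexivity: the canonical embedding J : V -> V^** (J x = (l |-> l x))
   is surjective onto the bounded linear functionals on V^*. *)
Definition reflexive_space (V : normedModType R) : Prop :=
  forall Phi : (V -> R) -> R,
    (forall (a : R) (l1 l2 : V -> R), lin_cont l1 -> lin_cont l2 ->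
        Phi (fun v => a * l1 v + l2 v) = a * Phi l1 + Phi l2) ->
    (exists C : R, forall (l : V -> R) (M : R), lin_cont l -> 0 <= M ->
        (forall h, `|l h| <= M * `|h|) -> `|Phi l| <= C * M) ->
    exists x : V, forall l, lin_cont l -> Phi l = l x.

Definition weakly_open {V : normedModType R} (A : set V) : Prop :=
  forall x, A x -> exists (n : nat) (l : nat -> V -> R),
    (forall i, (i < n)%N -> lin_cont (l i)) /\
    exists2 eps : R, 0 < eps &
      forall y, (forall i, (i < n)%N -> `|l i (y - x)| < eps) -> A y.

Definition weakly_closed {V : normedModType R} (A : set V) : Prop :=
  weakly_open (~` A).

Definition weakly_lsc {V : normedModType R} (F : V -> R) : Prop :=
  forall t : R, weakly_closed [set x | F x <= t].

Definition C1 {V W : normedModType R} (F : V -> W) : Prop :=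
  (forall x, differentiable F x) /\
  (forall x (eps : R), 0 < eps -> exists2 delta : R, 0 < delta &
     forall y, `|y - x| < delta -> forall h, `|'d F y h - 'd F x h| <= eps * `|h|).

Context {d : measure_display} {T : measurableType d}.
Variable mu : {measure set T -> \bar R}.

Definition inL2 (z : T -> R) : Prop :=
  measurable_fun setT z /\ finite_norm mu 2%:E z.

Definition L2norm (z : T -> R) : R := fine ('N[mu]_2%:E[EFin \o z]).

Definition L2inner (z w : T -> R) : R := fine (\int[mu]_t (z t * w t)%:E)%E.

Definition dense_embedding {Y : normedModType R} (e : Y -> T -> R) : Prop :=
  (forall y, inL2 (e y)) /\
  (forall (a : R) (y y' : Y), {ae mu, forall t, e (a *: y + y') t = a * e y t + e y' t}) /\
  (forall y (eps : R), 0 < eps -> exists2 delta : R, 0 < delta &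
     forall y', `|y' - y| < delta -> L2norm (e y' \- e y) < eps) /\
  (forall y, {ae mu, forall t, e y t = 0} -> y = 0) /\
  (forall z, inL2 z -> forall eps : R, 0 < eps -> exists y, L2norm (z \- e y) < eps).

Definition K_Y {Y : normedModType R} (e : Y -> T -> R) : set Y :=
  [set y | {ae mu, forall t, 0 <= e y t}].

Definition Yle0 {Y : normedModType R} (e : Y -> T -> R) (y : Y) : Prop :=
  K_Y e (- y).

(* z in Z regarded as the element e^* z of Y^*: y |-> (z, e y)_Z *)
Definition embZ {Y : normedModType R} (e : Y -> T -> R) (z : T -> R) : Y -> R :=
  fun y => L2inner z (e y).

Definition in_KYplus {Y : normedModType R} (e : Y -> T -> R) (lam : Y -> R) : Prop :=
  lin_cont lam /\ forall y, K_Y e y -> 0 <= lam y.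

Definition posp (z : T -> R) : T -> R := fun t => Num.max (z t) 0.
Definition negp (z : T -> R) : T -> R := fun t => Num.max (- z t) 0.

Definition local_solution {X Y : normedModType R} (e : Y -> T -> R)
    (f : X -> R) (g : X -> Y) (xbar : X) : Prop :=
  Yle0 e (g xbar) /\
  exists2 r : R, 0 < r &
    forall x, `|x - xbar| < r -> Yle0 e (g x) -> f xbar <= f x.

(* AKKT conditions; the multipliers lambda^k lie in Z, regarded in Y^* via e^*,
   so that the pairing <lambda^k, g_-(x^k)> is the L^2 inner product. *)
Definition AKKT {X Y : normedModType R} (e : Y -> T -> R)
    (f : X -> R) (g : X -> Y) (xbar : X) : Prop :=
  exists (xs : nat -> X) (zs : nat -> T -> R),
    xs @ \oo --> xbar /\
    (forall k, inL2 (zs k) /\ in_KYplus e (embZ e (zs k))) /\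
    (forall eps : R, 0 < eps -> \forall k \near \oo,
       forall h : X, `|'d f (xs k) h + embZ e (zs k) ('d g (xs k) h)| <= eps * `|h|) /\
    (fun k => L2inner (zs k) (negp (e (g (xs k))))) @ \oo --> 0.

End Defs.

(* Main.v *)
Require Import Defs.
From HB Require Import structures.
From mathcomp Require Import all_boot all_order all_algebra.
From mathcomp Require Import all_classical all_reals all_analysis.
From mathcomp Require Import measurable_realfun ring lra.
Import Order.TTheory GRing.Theory Num.Theory.
Import numFieldNormedType.Exports.
Local Open Scope classical_set_scope.
Local Open Scope ring_scope.

(** Near [xbar], minimize [f x + k * ||g_+(x)||^2 + eta * ||x - xbar||] over a
    closed ball.  Reflexivity makes bounded sequences converge weakly along an
    ultrafilter, so that weak lower semicontinuity (of the norm as well, by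
    Hahn-Banach) gives a minimizer [x]; the same compactness shows that
    [f + k * ||g_+||^2 >= f xbar - eta^2] on the ball once [k] is large.
    Comparing [x] with [xbar] then yields [||x - xbar|| <= eta].  The nonsmooth
    term has Lipschitz constant [eta], so the derivative at [x] of the smooth
    part, which is [f'(x) + g'(x)^* lambda] with [lambda = 2 k g_+(x)], has norm
    at most [eta]; and [lambda] is pointwise complementary to [g_-(x)]. *)

(** * Hahn-Banach *)

Section HahnBanach.
Context {R : realType} {V : normedModType R}.

(* A graph is kept as a relation; single-valuedness follows from domination,
   since [(0, r)] in a dominated linear graph forces [r = 0]. *)
Definition dominated_graph (A : set (V * R)) : Prop :=
  (forall (a : R) u v r s, A (u, r) -> A (v, s) -> A (a *: u + v, a * r + s)) /\
  (forall u r, A (u, r) -> r <= `|u|).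

Lemma dominated_graph_fun (A : set (V * R)) u r s : dominated_graph A ->
  A (u, r) -> A (u, s) -> r = s.
Proof.
move=> [Alin Adom] Ar As.
have A0 : A (0, s - r).
  have := Alin (-1) _ _ _ _ Ar As.
  by rewrite scaleN1r addNr mulN1r addrC.
have A0' : A (0, 0).
  have := Alin (-1) _ _ _ _ A0 A0.
  by rewrite scaleN1r addNr mulN1r addNr.
have := Alin (-1) _ _ _ _ A0 A0'; move/Adom: A0.
by rewrite normr0 => h /Adom; rewrite scaleN1r oppr0 !addr0 normr0; lra.
Qed.

(** The one-dimensional step of Hahn-Banach. A value [c] at [v] must satisfy
    [r - |u - v| <= c <= |w + v| - s] for all [(u, r)] and [(w, s)] in [A]; since
    [u + w = (u - v) + (w + v)], each left side is below each right side, and [c] can be the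
    supremum of the left sides. *)
Lemma dominated_graph_extend (A : set (V * R)) v : dominated_graph A ->
  A (0, 0) -> exists c, dominated_graph
    [set p | exists t u r, A (u, r) /\ p = (u + t *: v, r + t * c)].
Proof.
move=> [Alin Adom] A0.
have AD u1 u2 r1 r2 : A (u1, r1) -> A (u2, r2) -> A (u1 + u2, r1 + r2).
  by move=> h1 h2; have := Alin 1 _ _ _ _ h1 h2; rewrite scale1r mul1r.
have AZ a u r : A (u, r) -> A (a *: u, a * r).
  by move=> h; have := Alin a _ _ _ _ h A0; rewrite !addr0.
pose S := [set x : R | exists u r, A (u, r) /\ x = r - `|u - v|].
have Sub w s : A (w, s) -> ubound S (`|w + v| - s).
  move=> Aws _ [u [r [Aur ->]]].
  rewrite lerBrDr -addrA [- _ + _]addrC addrA lerBlDr.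
  apply: le_trans (Adom _ _ (AD _ _ _ _ Aur Aws)) _.
  have -> : u + w = (w + v) + (u - v) by rewrite addrACA subrr addr0 addrC.
  exact: ler_normD.
have S0 : S !=set0 by exists (0 - `|0 - v|); exists 0, 0.
have hS : has_sup S by split => //; exists (`|0 + v| - 0); exact: Sub.
exists (sup S); split.
  move=> a _ _ _ _ [t1 [u1 [r1 [h1 [-> ->]]]]] [t2 [u2 [r2 [h2 [-> ->]]]]].
  exists (a * t1 + t2), (a *: u1 + u2), (a * r1 + r2); split; first exact: Alin.
  congr pair; last by ring.
  by rewrite scalerDr scalerDl scalerA addrACA.
move=> _ _ [t [u [r [Aur [-> ->]]]]].
(* Dividing by [|t|] reduces [t < 0] to the lower bounds on [c] and [t > 0] to the upper ones. *)
have [t0|t0|->] := ltgtP t 0; last by rewrite scale0r mul0r !addr0; exact: Adom.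
- have t'0 : 0 < - t by rewrite oppr_gt0.
  have : S ((- t)^-1 * r - `|(- t)^-1 *: u - v|).
    by exists ((- t)^-1 *: u), ((- t)^-1 * r); split => //; exact: AZ.
  move/(ubP _ _).1: (sup_upper_bound hS) => /[apply].
  have -> : u + t *: v = (- t) *: ((- t)^-1 *: u - v).
    by rewrite scalerBr scalerA divff ?gt_eqF// scale1r scaleNr opprK.
  rewrite normrZ gtr0_norm//.
  rewrite -(ler_pM2l t'0) mulrBr mulrA divff ?gt_eqF// mul1r; lra.
- have : sup S <= `|t^-1 *: u + v| - t^-1 * r.
    by apply: ge_sup => //; apply: Sub; exact: AZ.
  have -> : u + t *: v = t *: (t^-1 *: u + v).
    by rewrite scalerDr scalerA divff ?gt_eqF// scale1r.
  rewrite normrZ gtr0_norm//.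
  by rewrite -(ler_pM2l t0) mulrBr mulrA divff ?gt_eqF// mul1r; lra.
Qed.

(** A maximal dominated graph through [(x0, |x0|)] is defined everywhere, as it could otherwise be
    extended by one dimension; it is the graph of [l]. *)
Lemma norming_functional (x0 : V) : exists l : V -> R,
  [/\ lin_cont l, forall v, `|l v| <= `|v| & l x0 = `|x0|].
Proof.
(* The guard [A !=set0] admits the empty graph, which is the union of the empty chain. *)
pose P (A : set (V * R)) := dominated_graph A /\ (A !=set0 -> A (x0, `|x0|)).
have P_chain (F : set (set (V * R))) : F `<=` P -> total_on F subset ->
    P (\bigcup_(X in F) X).
  move=> FP Ftot; split; last first.
    by move=> [p [X FX Xp]]; exists X => //; apply: (FP _ FX).2; exists p.
  split; last by move=> u r [X FX]; exact: (FP _ FX).1.2.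
  move=> a u v r s [X FX Xu] [Z FZ Zv].
  have [XZ|ZX] := Ftot _ _ FX FZ.
    by exists Z => //; apply: (FP _ FZ).1.1 => //; exact: XZ.
  by exists X => //; apply: (FP _ FX).1.1 => //; exact: ZX.
have [A [[dA Ax0] Amax]] := Zorn_bigcup P_chain.
have [Alin Adom] := dA.
have Ax : A (x0, `|x0|).
  apply: contrapT => nAx.
  have A_0 : A = set0.
    by apply/eqP/negPn/negP => /set0P /Ax0.
  (* The empty graph is not maximal: the line through [(x0, |x0|)] is larger. *)
  apply: (Amax [set p | exists t, p = (t *: x0, t * `|x0|)]).
    rewrite A_0; split; first exact: sub0set.
    by move/(_ (0 *: x0, 0 * `|x0|)) => h; apply: h; exists 0.
  split; last by move=> _; exists 1; rewrite scale1r mul1r.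
  split.
    move=> a _ _ _ _ [t [-> ->]] [t' [-> ->]]; exists (a * t + t').
    by rewrite scalerDl scalerA mulrDl mulrA.
  by move=> _ _ [t [-> ->]]; rewrite normrZ ler_wpM2r// ler_norm.
have A0 : A (0, 0).
  by have := Alin (-1) _ _ _ _ Ax Ax; rewrite scaleN1r addNr mulN1r addNr.
have Atotal v : exists r, A (v, r).
  apply: contrapT => nAv.
  have [c dB] := dominated_graph_extend _ v dA A0.
  apply: (Amax _ _ (conj dB _)).
    split=> [[u r] Aur|].
      by exists 0, u, r; split => //; rewrite scale0r mul0r !addr0.
    move/(_ (v, c)) => h; apply: nAv; exists c; apply: h.
    by exists 1, 0, 0; split => //; rewrite scale1r mul1r !add0r.
  by move=> _; exists 0, x0, `|x0|; split => //; rewrite scale0r mul0r !addr0.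
have [l lA] := choice Atotal.
have llin (a : R) u v : l (a *: u + v) = a * l u + l v.
  by apply: (dominated_graph_fun _ _ _ _ dA (lA _)); exact: Alin.
have lN v : l (- v) = - l v.
  have l0 : l 0 = 0 by exact: (dominated_graph_fun _ _ _ _ dA (lA _) A0).
  by have := llin (-1) v 0; rewrite scaleN1r !addr0 l0 addr0 mulN1r.
have lnorm v : `|l v| <= `|v|.
  rewrite ler_norml Adom// andbT lerNl -lN -normrN; exact: Adom.
exists l; split => //; last exact: (dominated_graph_fun _ _ _ _ dA (lA _) Ax).
split => // v; apply/cvgrPdist_lt => eps eps0; near=> w.
have -> : l v - l w = l (v - w).
  have := llin (-1) w v; rewrite scaleN1r [- w + v]addrC => ->.
  by rewrite mulN1r addrC.
by apply: le_lt_trans (lnorm _) _; near: w; exact: cvgr_dist_lt.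
Unshelve. all: by end_near.
Qed.

End HahnBanach.

(** * Weak convergence in reflexive spaces *)

Section Weak.
Context {R : realType} {V : normedModType R}.
Implicit Types (l : V -> R) (F : V -> R) (u : nat -> V).

Lemma lin_cont0 l : lin_cont l -> l 0 = 0.
Proof.
move=> [lin _]; have := lin (-1) 0 0.
by rewrite scaleN1r oppr0 addr0 mulN1r addNr.
Qed.

Lemma lin_contB l x y : lin_cont l -> l (x - y) = l x - l y.
Proof.
move=> [lin _]; have := lin (-1) y x.
by rewrite scaleN1r [- y + x]addrC => ->; rewrite mulN1r addrC.
Qed.

Lemma lin_contZ l (a : R) x : lin_cont l -> l (a *: x) = a * l x.
Proof. by move=> hl; rewrite -[a *: x]addr0 hl.1 lin_cont0// addr0. Qed.

Lemma lin_cont_bounded l : lin_cont l ->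
  exists2 M : R, 0 <= M & forall h, `|l h| <= M * `|h|.
Proof.
move=> hl; have [lin cl] := hl.
have : l x @[x --> 0] --> l 0 := cl 0.
rewrite lin_cont0// => /cvgrPdist_lt/(_ 1 ltr01) /nbhs_ballP.
move=> [del /= del0 hdel].
(* Rescaled to norm [del / 2], [h] enters the ball on which [|l| < 1]. *)
exists (2 / del) => [|h]; first by rewrite divr_ge0// ltW.
have [->|h0] := eqVneq h 0; first by rewrite lin_cont0// !normr0 mulr0.
have nh : 0 < `|h| by rewrite normr_gt0.
pose c := del / 2 / `|h|.
have c0 : 0 < c by rewrite !divr_gt0.
have : ball (0 : V) del (c *: h).
  rewrite -ball_normE /ball_ /= sub0r normrN normrZ gtr0_norm// /c divfK ?gt_eqF//.
  by lra.
move/hdel => /=; rewrite sub0r normrN lin_contZ// normrM gtr0_norm// => h1.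
have -> : 2 / del * `|h| = c^-1.
  by rewrite /c; field; rewrite ?gt_eqF.
by rewrite -(ler_pM2l c0) divff ?gt_eqF// ltW.
Qed.

(** Along an ultrafilter, bounded scalar sequences converge, so no subsequences have to be
    extracted. *)
Definition weak_cvg_along (U : set_system nat) u (x : V) : Prop :=
  forall l, lin_cont l -> l (u n) @[n --> U] --> l x.

(* The limits of [l (u n)] along an ultrafilter define an element of the bidual. *)
Lemma reflexive_weak_cvg u (M : R) (U : set_system nat) :
  reflexive_space V -> UltraFilter U -> (forall n, `|u n| <= M) ->
  exists x, weak_cvg_along U u x.
Proof.
move=> refl UU uM.
have lim_ex l : lin_cont l -> exists c : R, l (u n) @[n --> U] --> c.
  move=> /lin_cont_bounded[C C0 hC].
  have UC : U [set n | (l \o u) n \in `[- (C * M), C * M]].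
    apply: (filterS _ (@filterT _ U _)) => n _ /=; rewrite in_itv/= -ler_norml.
    by rewrite (le_trans (hC _))// ler_wpM2l.
  have [c [_ lc]] := @segment_compact R (- (C * M)) (C * M) (l \o u @ U) _ UC.
  (* A cluster point of an ultrafilter is a limit: otherwise the complement of some neighbourhood
     [N] would belong to it and would have to meet [N]. *)
  exists c => N cN; have [//|UN] := in_ultra_setVsetC ((l \o u) @^-1` N) UU.
  by have [y []] := lc (~` N) N UN cN.
pose Phi l := lim (l (u n) @[n --> U]).
have PhiP l : lin_cont l -> l (u n) @[n --> U] --> Phi l.
  by move=> /lim_ex[c hc]; rewrite /Phi (cvg_lim _ hc).
have [||x hx] := refl Phi.
- move=> a l1 l2 h1 h2; apply: cvg_lim => //.
  by apply: cvgD; [apply: cvgM; [exact: cvg_cst|exact: PhiP]|exact: PhiP].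
- exists M => l C hl C0 hC.
  suff : forall n, `|l (u n)| <= M * C => [luM|n]; last first.
    by rewrite (le_trans (hC _))// mulrC ler_wpM2r.
  have : `|l (u n)| @[n --> U] --> `|Phi l| by apply: cvg_norm; exact: PhiP.
  by move/cvgr_to_le; apply; exact: nearW.
by exists x => l hl; rewrite -hx//; exact: PhiP.
Qed.

(** The set where [a < F] is weakly open, and a basic weak neighbourhood of [x] tests only finitely
    many functionals; the induction intersects the corresponding sets of [U]. *)
Lemma weakly_lsc_near (U : set_system nat) {UU : Filter U} F u x (a : R) :
  weakly_lsc F -> weak_cvg_along U u x -> a < F x ->
  \forall n \near U, a < F (u n).
Proof.
move=> lscF ux aFx.
have [|n [l [hl [eps eps0 heps]]]] := lscF a x.
  by move=> /=; apply/negP; rewrite -ltNge.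
suff : \forall k \near U, forall i, (i < n)%N -> `|l i (u k - x)| < eps.
  by apply: filterS => k /heps /= /negP; rewrite -ltNge.
elim: n hl {heps} => [|n IH] hl; first exact: nearW.
have near_n : \forall k \near U, `|l n (u k - x)| < eps.
  have := ux _ (hl n (ltnSn n)) => /cvgrPdist_lt/(_ _ eps0).
  by apply: filterS => k; rewrite distrC lin_contB//; exact: hl.
have near_lt : \forall k \near U, forall i, (i < n)%N -> `|l i (u k - x)| < eps.
  by apply: IH => i /ltnW; exact: hl.
move: near_n near_lt; apply: filterS2 => k kn klt i.
by rewrite ltnS leq_eqVlt => /predU1P[->//|]; exact: klt.
Qed.

(** With [l] norming [x - c], one has [|y - c| >= l (y - x) + |x - c|], which exceeds [t] once
    [|l (y - x)| < |x - c| - t]. *)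
Lemma weakly_lsc_dist (c : V) : weakly_lsc (fun x => `|x - c|).
Proof.
move=> t x /= /negP; rewrite -ltNge => tx.
have [l [hl lnorm lx]] := norming_functional (x - c).
exists 1%N, (fun=> l); split => //.
exists (`|x - c| - t); first by rewrite subr_gt0.
move=> y /(_ 0%N isT) hy; apply/negP; rewrite -ltNge.
apply: lt_le_trans (le_trans (ler_norm _) (lnorm (y - c))).
have -> : l (y - c) = l (y - x) + l (x - c).
  by rewrite !lin_contB// addrA subrK.
by move: hy; rewrite lx ltr_norml => /andP[]; lra.
Qed.

End Weak.

(** * The space L2 *)

Section L2.
Context {R : realType} {d : measure_display} {T : measurableType d}.
Variable mu : {measure set T -> \bar R}.
Implicit Types z w v : T -> R.

Lemma inL2_Lfun z : inL2 mu z <-> z \in Lfun mu 2%:E.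
Proof.
split=> [[mz fz]|]; first by rewrite inE; apply/andP; split; rewrite inE.
by rewrite inE => /andP[/[!inE]/= mz fz].
Qed.

Lemma inL2_mul_integrable z w : inL2 mu z -> inL2 mu w ->
  mu.-integrable setT (EFin \o (fun t => z t * w t)).
Proof.
move=> /inL2_Lfun hz /inL2_Lfun hw.
exact/Lfun1_integrable/Lfun2_mul_Lfun1.
Qed.

Lemma inL2P z : inL2 mu z <->
  measurable_fun setT z /\ mu.-integrable setT (EFin \o (fun t => z t * z t)).
Proof.
split=> [hz|[mz iz]]; first by split; [case: hz|exact: inL2_mul_integrable].
split => //; rewrite /finite_norm unlock; apply: poweR_lty.
have /integrableP[_] := iz; congr (_ < _)%E; apply: eq_integral => t _ /=.
by rewrite powR_mulrn// -normrX expr2.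
Qed.

Lemma inL2D z w : inL2 mu z -> inL2 mu w -> inL2 mu (fun t => z t + w t).
Proof.
move=> /inL2_Lfun hz /inL2_Lfun hw; apply/inL2_Lfun.
exact: (Lfun_addr_closed mu (lee1n 2)).2.
Qed.

Lemma inL2Z (a : R) z : inL2 mu z -> inL2 mu (fun t => a * z t).
Proof.
move=> /inL2P[mz iz]; apply/inL2P; split; first exact: measurable_funM.
apply: eq_integrable (integrableZl measurableT (a * a) iz) => // t _ /=.
by rewrite -EFinM; congr EFin; ring.
Qed.

Lemma inL2_le z w : measurable_fun setT w -> (forall t, `|w t| <= `|z t|) ->
  inL2 mu z -> inL2 mu w.
Proof.
move=> mw wz /inL2P[mz iz]; apply/inL2P; split => //.
apply: le_integrable iz => //; first by apply/measurable_EFinP; exact: measurable_funM.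
by move=> t _; rewrite lee_fin !normrM ler_pM.
Qed.

Lemma inL2_posp z : inL2 mu z -> inL2 mu (posp z).
Proof.
move=> hz; apply: inL2_le (hz); first exact: measurable_maxr hz.1 _.
move=> t; rewrite /posp /Num.max; case: ifP => h; rewrite ?normr0//.
Qed.

Lemma L2inner_ae z w z' w' : inL2 mu z -> inL2 mu w -> inL2 mu z' -> inL2 mu w' ->
  {ae mu, forall t, z t * w t = z' t * w' t} -> L2inner mu z w = L2inner mu z' w'.
Proof.
move=> hz hw hz' hw' E; congr fine; apply: ae_eq_integral => //.
- by have /measurable_int := inL2_mul_integrable _ _ hz hw.
- by have /measurable_int := inL2_mul_integrable _ _ hz' hw'.
- by apply: filterS E => t + _ => /= ->.
Qed.

Lemma L2innerDr z w v : inL2 mu z -> inL2 mu w -> inL2 mu v ->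
  L2inner mu z (fun t => w t + v t) = L2inner mu z w + L2inner mu z v.
Proof.
move=> hz hw hv; rewrite /L2inner -[RHS]RintegralD//; try exact: inL2_mul_integrable.
by congr fine; apply: eq_integral => t _; rewrite mulrDr.
Qed.

Lemma L2innerZr (a : R) z w : inL2 mu z -> inL2 mu w ->
  L2inner mu z (fun t => a * w t) = a * L2inner mu z w.
Proof.
move=> hz hw; rewrite /L2inner -[RHS]RintegralZl//; try exact: inL2_mul_integrable.
by congr fine; apply: eq_integral => t _; rewrite mulrCA.
Qed.

Lemma L2innerC z w : L2inner mu z w = L2inner mu w z.
Proof. by congr fine; apply: eq_integral => t _; rewrite mulrC. Qed.

Lemma L2inner_ge0 z w : inL2 mu z -> inL2 mu w ->
  {ae mu, forall t, 0 <= z t * w t} -> 0 <= L2inner mu z w.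
Proof.
move=> hz hw zw0.
have := inL2_mul_integrable _ _ hz hw => izw.
(* The product is nonnegative only almost everywhere; its absolute value is so everywhere. *)
have -> : L2inner mu z w = \int[mu]_t `|z t * w t|.
  congr fine; apply: ae_eq_integral => //.
  - by have /measurable_int := izw.
  - by have /integrable_norm/measurable_int := izw.
  - by apply: filterS zw0 => t h _ /=; rewrite ger0_norm.
by apply: Rintegral_ge0.
Qed.

Lemma L2norm_ge0 z : 0 <= L2norm mu z.
Proof. by rewrite fine_ge0// Lnorm_ge0. Qed.

Lemma L2normE z : inL2 mu z -> (L2norm mu z)%:E = 'N[mu]_2%:E[EFin \o z]%E.
Proof. by move=> [_ hz]; rewrite fineK// ge0_fin_numE// Lnorm_ge0. Qed.

Lemma L2norm_sqr z : inL2 mu z -> L2norm mu z ^+ 2 = L2inner mu z z.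
Proof.
move=> hz; have [_ iz] := (inL2P z).1 hz.
have h := @poweR_Lnorm _ _ _ mu (EFin \o z) 2 (negbT (@pnatr_eq0 R 2)).
rewrite /L2inner -[LHS]/(fine _%:E) -powR_mulrn ?L2norm_ge0// -poweR_EFin L2normE// h.
congr fine; apply: eq_integral => t _ /=.
by rewrite powR_mulrn// -normrX expr2 ger0_norm// -expr2 sqr_ge0.
Qed.

Lemma L2norm_eq0 z : inL2 mu z ->
  L2norm mu z = 0 <-> {ae mu, forall t, z t = 0}.
Proof.
move=> hz; split=> [nz0|z0].
  have N0 : ('N[mu]_2%:E[EFin \o z] = 0)%E by rewrite -L2normE// nz0.
  have mz : measurable_fun setT (EFin \o z) by apply/measurable_EFinP; case: hz.
  by apply: filterS (Lnorm_eq0_eq0 mz _ N0) => // t /(_ I) [].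
apply/eqP; rewrite -sqrf_eq0 L2norm_sqr//.
rewrite (@L2inner_ae _ _ z (fun t => 0 * z t))//; last 2 first.
- exact: inL2Z.
- by apply: filterS z0 => t ->; rewrite !mul0r.
by rewrite L2innerZr// mul0r.
Qed.

Lemma L2inner_cauchy_schwarz z w : inL2 mu z -> inL2 mu w ->
  `|L2inner mu z w| <= L2norm mu z * L2norm mu w.
Proof.
move=> hz hw; have izw := inL2_mul_integrable _ _ hz hw.
apply: le_trans (le_normr_Rintegral measurableT izw) _.
have : (2^-1 + 2^-1 = 1 :> R) by rewrite [RHS]splitr !div1r.
move/(@hoelder _ _ _ mu z w 2 2 hz.1 hw.1 (ltr0Sn _ 1) (ltr0Sn _ 1)).
rewrite -lee_fin EFinM !L2normE// Lnorm1 => /(le_trans _); apply.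
rewrite /Rintegral fineK//; apply: integrable_fin_num => //.
exact: integrable_norm.
Qed.

Lemma L2norm_le_ae z w : inL2 mu z -> inL2 mu w ->
  {ae mu, forall t, `|z t| <= `|w t|} -> L2norm mu z <= L2norm mu w.
Proof.
move=> hz hw zw.
rewrite -(@ler_pXn2r _ 2%N) ?nnegrE ?L2norm_ge0// !L2norm_sqr//.
have izz := inL2_mul_integrable _ _ hz hz.
have iww := inL2_mul_integrable _ _ hw hw.
apply: fine_le; [exact: integrable_fin_num izz|exact: integrable_fin_num iww|].
apply: ae_ge0_le_integral => //.
- by move=> t _; rewrite lee_fin -expr2 sqr_ge0.
- by have /measurable_int := izz.
- by move=> t _; rewrite lee_fin -expr2 sqr_ge0.
- by have /measurable_int := iww.
apply: filterS zw => t h _; rewrite lee_fin -!expr2.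
by rewrite -ler_sqrt ?sqr_ge0// !sqrtr_sqr.
Qed.

Lemma L2norm_ae z w : inL2 mu z -> inL2 mu w ->
  {ae mu, forall t, z t = w t} -> L2norm mu z = L2norm mu w.
Proof.
move=> hz hw zw; apply/le_anti/andP; split; apply: L2norm_le_ae => //.
  by apply: filterS zw => t ->.
by apply: filterS zw => t ->.
Qed.

Lemma L2normZ (a : R) z : inL2 mu z ->
  L2norm mu (fun t => a * z t) = `|a| * L2norm mu z.
Proof.
move=> hz; have haz := inL2Z a _ hz.
apply/eqP; rewrite -(@eqrXn2 _ 2%N) ?mulr_ge0 ?L2norm_ge0//.
rewrite exprMn real_normK ?num_real// !L2norm_sqr// L2innerZr//.
by rewrite L2innerC L2innerZr// mulrA.
Qed.

Lemma L2norm_sqrD z w : inL2 mu z -> inL2 mu w ->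
  L2norm mu (fun t => z t + w t) ^+ 2 =
  L2norm mu z ^+ 2 + 2 * L2inner mu z w + L2norm mu w ^+ 2.
Proof.
move=> hz hw; have hzw := inL2D _ _ hz hw.
rewrite !L2norm_sqr// L2innerDr// [L2inner mu _ z]L2innerC.
by rewrite [L2inner mu (fun _ => _) w]L2innerC !L2innerDr// [L2inner mu w z]L2innerC; ring.
Qed.

(** Complementarity: at each point one of the two parts of [z] vanishes. *)
Lemma L2inner_posp_negp (a : R) z :
  L2inner mu (fun t => a * posp z t) (negp z) = 0.
Proof.
rewrite /L2inner (_ : (fun t => _) = cst 0%E) ?integral_cst ?mul0e//.
apply/funext => t; rewrite /posp /negp; congr EFin.
case: (leP (z t) 0) => h; rewrite ?mulr0 ?mul0r//.
by rewrite (@max_r _ _ _ 0) ?mulr0// oppr_le0 ltW.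
Qed.

End L2.

(** * Dense embeddings into L2 *)

Section Embedding.
Context {R : realType} {Y : normedModType R}.
Context {d : measure_display} {T : measurableType d}.
Variables (mu : {measure set T -> \bar R}) (e : Y -> T -> R).
Hypothesis he : dense_embedding mu e.

Let eL2 y : inL2 mu (e y). Proof. by case: he. Qed.

Lemma embedding0 : {ae mu, forall t, e 0 t = 0}.
Proof.
have [_ [lin _]] := he; apply: filterS (lin (-1) 0 0) => t.
by rewrite scaleN1r oppr0 addr0 mulN1r addNr.
Qed.

Lemma embeddingZ (a : R) y : {ae mu, forall t, e (a *: y) t = a * e y t}.
Proof.
have [_ [lin _]] := he; apply: filterS2 embedding0 (lin a y 0) => t e0.
by rewrite addr0 e0 addr0.
Qed.

Lemma embeddingB y y' : {ae mu, forall t, e y' t = e y t + e (y' - y) t}.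
Proof.
have [_ [lin _]] := he; apply: filterS (lin 1 y (y' - y)) => t.
by rewrite scale1r mul1r addrC subrK.
Qed.

Lemma embedding_bounded : exists2 C : R, 0 <= C &
  forall y, L2norm mu (e y) <= C * `|y|.
Proof.
have [_ [_ [cont _]]] := he; have [del del0 hdel] := cont 0 1 ltr01.
exists (2 / del) => [|y]; first by rewrite divr_ge0// ltW.
have [->|y0] := eqVneq y 0.
  by rewrite normr0 mulr0 (L2norm_eq0 _ _ (eL2 0)).2//; exact: embedding0.
have ny : 0 < `|y| by rewrite normr_gt0.
pose c := del / 2 / `|y|.
have c0 : 0 < c by rewrite !divr_gt0.
have : `|c *: y - 0| < del.
  rewrite subr0 normrZ gtr0_norm// /c divfK ?gt_eqF//; lra.
move/hdel; rewrite (_ : L2norm _ _ = c * L2norm mu (e y)); last first.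
  rewrite -[X in X * _](gtr0_norm c0) -L2normZ//; apply: L2norm_ae.
  - rewrite (_ : _ \- _ = (fun t => e (c *: y) t + (-1) * e 0 t)).
      by apply: inL2D => //; exact: inL2Z.
    by apply/funext => t /=; rewrite mulN1r.
  - exact: inL2Z.
  apply: filterS2 embedding0 (embeddingZ c y) => t /= -> ->.
  by rewrite subr0.
have -> : 2 / del * `|y| = c^-1 by rewrite /c; field; rewrite ?gt_eqF.
by move=> h; rewrite -(ler_pM2l c0) divff ?gt_eqF// ltW.
Qed.

Lemma embZ_lin_cont z : inL2 mu z -> lin_cont (embZ mu e z).
Proof.
move=> hz.
have lin (a : R) y y' :
    embZ mu e z (a *: y + y') = a * embZ mu e z y + embZ mu e z y'.
  rewrite /embZ -L2innerZr// -L2innerDr//; last exact: inL2Z.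
  apply: L2inner_ae => //; first by apply: inL2D => //; exact: inL2Z.
  by have [_ [elin _]] := he; apply: filterS (elin a y y') => t ->.
split => // y; have [C C0 hC] := embedding_bounded.
(* The summand [1] makes [M] positive, so that [eps] can be divided by it. *)
pose M := L2norm mu z * C + 1.
have M0 : 0 < M by rewrite ltr_wpDl// mulr_ge0// L2norm_ge0.
apply/cvgrPdist_le => eps eps0; near=> y'.
have -> : embZ mu e z y - embZ mu e z y' = embZ mu e z (y - y').
  have := lin (-1) y' y; rewrite scaleN1r [- y' + y]addrC => ->.
  by rewrite mulN1r addrC.
apply: le_trans (L2inner_cauchy_schwarz _ _ _ hz (eL2 _)) _.
apply: (@le_trans _ _ (M * `|y - y'|)).
  apply: (@le_trans _ _ (L2norm mu z * (C * `|y - y'|))).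
    by rewrite ler_wpM2l// L2norm_ge0.
  by rewrite mulrA ler_wpM2r// lerDl.
rewrite -ler_pdivlMl//; near: y'.
by apply: cvgr_dist_le => //; rewrite mulr_gt0// invr_gt0.
Unshelve. all: by end_near.
Qed.

Lemma embZ_in_KYplus z : inL2 mu z -> (forall t, 0 <= z t) ->
  in_KYplus mu e (embZ mu e z).
Proof.
move=> hz z0; split=> [|y Ky]; first exact: embZ_lin_cont.
by apply: L2inner_ge0 => //; apply: filterS Ky => t ?; rewrite mulr_ge0.
Qed.

(** Feasibility becomes the vanishing of the penalty term. *)
Lemma Yle0P y : Yle0 mu e y <-> L2norm mu (posp (e y)) = 0.
Proof.
rewrite L2norm_eq0; last exact: inL2_posp.
have eN := embeddingZ (-1) y.
split=> [|h]; rewrite /Yle0 /K_Y /=.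
  move=> h; apply: filterS2 eN h => t; rewrite scaleN1r => ->.
  by rewrite mulN1r oppr_ge0 /posp => ?; rewrite max_r.
apply: filterS2 eN h => t; rewrite scaleN1r => ->.
by rewrite mulN1r oppr_ge0 /posp /Num.max; case: ifP => [/ltW//|_ ->].
Qed.

(* Pointwise, [b_+ <= |a_+ + (b - a)|]: this one-sided first order expansion of
   the squared penalty replaces its differentiability. *)
Lemma penalty_upper_expansion y y' :
  L2norm mu (posp (e y')) ^+ 2 <= L2norm mu (posp (e y)) ^+ 2 +
    2 * embZ mu e (posp (e y)) (y' - y) + L2norm mu (e (y' - y)) ^+ 2.
Proof.
have hp u := inL2_posp _ _ (eL2 u).
rewrite -L2norm_sqrD// ler_pXn2r ?nnegrE ?L2norm_ge0//.
apply: L2norm_le_ae => //; first exact: inL2D.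
apply: filterS (embeddingB y y') => t ey'; rewrite /posp ey'.
rewrite [leLHS]ger0_norm ?le_max ?lexx ?orbT// ge_max normr_ge0 andbT.
by rewrite (le_trans _ (ler_norm _))// lerD2r le_max lexx.
Qed.

End Embedding.

(** * Penalization *)

Section Penalty.
Context {R : realType} {V : normedModType R}.
Variables (F G : V -> R) (c : V) (r : R).
Hypothesis refl : reflexive_space V.
Hypotheses (F_lsc : weakly_lsc F) (G_lsc : weakly_lsc G).
Hypothesis G_ge0 : forall x, 0 <= G x.

(** Weak compactness of the closed ball: the limit stays inside because the distance to [c] is
    weakly lower semicontinuous. As [U] refines [eventually], large indices remain available. *)
Lemma reflexive_ball_weak_cvg (u : nat -> V) :
  (forall n, `|u n - c| <= r) -> exists U x,
    [/\ UltraFilter U, eventually `<=` U, `|x - c| <= r & weak_cvg_along U u x].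
Proof.
move=> ur; have [U [UU subU]] := ultraFilterLemma (F := eventually) _.
have [|x ux] := @reflexive_weak_cvg _ _ u (r + `|c|) U refl UU.
  by move=> n; rewrite -{1}[u n](subrK c) (le_trans (ler_normD _ _))// lerD2r.
exists U, x; split => //; rewrite leNgt; apply/negP => rx.
have /filter_ex[n] : \forall n \near U, r < `|u n - c|.
  exact: weakly_lsc_near (weakly_lsc_dist c) ux rx.
by rewrite ltNge ur.
Qed.

(** If every [k = n] fails at some [u n], let [x] be a weak limit of these points. If [G x = 0],
    then [F x >= F c] and lower semicontinuity contradicts [F (u n) < F c - eps]; if [G x > 0], then
    [n * G (u n) ^+ 2] grows without bound while [F (u n)] stays above [F x - 1]. *)
Lemma penalty_lower_bound (eps : R) : 0 < eps ->
  (forall x, `|x - c| <= r -> G x = 0 -> F c <= F x) ->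
  exists2 k : R, 0 <= k &
    forall x, `|x - c| <= r -> F c - eps <= F x + k * G x ^+ 2.
Proof.
move=> eps0 cmin; apply: contrapT => nk.
have bad (n : nat) : exists x, `|x - c| <= r /\ F x + n%:R * G x ^+ 2 < F c - eps.
  apply: contrapT => nx; apply: nk; exists n%:R => // x xr.
  by rewrite leNgt; apply/negP => h; apply: nx; exists x.
have [u /all_and2[ur uF]] := choice bad.
have [U [x [UU subU xr ux]]] := reflexive_ball_weak_cvg u ur.
have F_near (a : R) : a < F x -> \forall n \near U, a < F (u n).
  exact: weakly_lsc_near F_lsc ux.
have G_near (a : R) : a < G x -> \forall n \near U, a < G (u n).
  exact: weakly_lsc_near G_lsc ux.
have [G0|Gn0] := eqVneq (G x) 0.
  have /F_near/filter_ex[n Fn] : F c - eps < F x.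
    by have := cmin _ xr G0; lra.
  have Gn : 0 <= n%:R * G (u n) ^+ 2 by rewrite mulr_ge0 ?sqr_ge0.
  by have := uF n; lra.
have Gx : 0 < G x by rewrite lt0r Gn0 G_ge0.
have /F_near nF : F x - 1 < F x by lra.
have /G_near nG : G x / 2 < G x by lra.
(* For [n > D], the penalty [n * (G x / 2) ^+ 2] alone exceeds [F c - eps - (F x - 1)]. *)
pose D := (F c - eps - F x + 1) / (G x / 2) ^+ 2.
have nD : U [set n | D < n%:R].
  by apply: subU; exact: nbhs_infty_gtr.
have [n [[Fn Gn] Dn]] := filter_ex (filterI (filterI nF nG) nD).
have := uF n; apply/negP; rewrite -leNgt.
have G2 : 0 < (G x / 2) ^+ 2 by rewrite exprn_gt0// divr_gt0.
have h1 : F c - eps - F x + 1 < n%:R * (G x / 2) ^+ 2 by rewrite -ltr_pdivrMr.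
have h2 : (G x / 2) ^+ 2 <= G (u n) ^+ 2.
  by rewrite ler_pXn2r ?nnegrE ?divr_ge0// ltW.
have := ler_wpM2l (ler0n R n) h2; move: Fn => /=; lra.
Qed.

(** The direct method: a weak limit of a minimizing sequence is a minimizer, each of the three
    summands being weakly lower semicontinuous. The bound [m] makes the infimum finite. *)
Lemma penalized_minimizer (k eta m : R) : 0 <= r -> 0 <= k -> 0 <= eta ->
  (forall x, `|x - c| <= r -> m <= F x + k * G x ^+ 2) ->
  exists2 x, `|x - c| <= r & forall y, `|y - c| <= r ->
    F x + k * G x ^+ 2 + eta * `|x - c| <= F y + k * G y ^+ 2 + eta * `|y - c|.
Proof.
move=> r0 k0 eta0 Fm.
pose phi x := F x + k * G x ^+ 2 + eta * `|x - c|.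
pose A := [set phi x | x in [set x | `|x - c| <= r]].
have A_inf : has_inf A.
  split; first by exists (phi c), c => //=; rewrite subrr normr0.
  exists m => _ [x /= xr <-]; rewrite (le_trans (Fm _ xr))// lerDl mulr_ge0//.
have approx (n : nat) : exists x, `|x - c| <= r /\ phi x < inf A + n.+1%:R^-1.
  have n0 : 0 < n.+1%:R^-1 :> R by rewrite invr_gt0.
  have [_ [x /= xr <-] hx] := inf_adherent n0 A_inf.
  by exists x.
have [u /all_and2[ur uphi]] := choice approx.
have [U [x [UU subU xr ux]]] := reflexive_ball_weak_cvg u ur.
exists x => // y yr; rewrite -/(phi x) -/(phi y).
apply: (@le_trans _ _ (inf A)); last by apply: ge_inf; [case: A_inf|exists y].
apply/ler_addgt0Pr => del del0.
(* One [b] for each of the three summands, one for the gap to the infimum, and one of slack. *)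
pose b := del / 5.
have b0 : 0 < b by rewrite divr_gt0.
(* [s] and [s'] make the losses [k * (2 * G x) * s] and [eta * s'] at most [b]; adding [1] keeps the
   denominators positive. *)
pose s := b / (k * (2 * G x) + 1).
pose s' := b / (eta + 1).
have D0 : 0 < k * (2 * G x) + 1 by rewrite ltr_wpDl// !mulr_ge0.
have D'0 : 0 < eta + 1 by rewrite ltr_wpDl.
have s0 : 0 < s by rewrite divr_gt0.
have s'0 : 0 < s' by rewrite divr_gt0.
have nF : \forall n \near U, F x - b < F (u n).
  by apply: weakly_lsc_near F_lsc ux _; rewrite ltrBlDr ltrDl.
have nG : \forall n \near U, G x - s < G (u n).
  by apply: weakly_lsc_near G_lsc ux _; rewrite ltrBlDr ltrDl.
have nN : \forall n \near U, `|x - c| - s' < `|u n - c|.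
  by apply: weakly_lsc_near (weakly_lsc_dist c) ux _; rewrite ltrBlDr ltrDl.
have nb : \forall n \near U, n.+1%:R^-1 < b.
  by apply: subU; exact: near_infty_natSinv_lt (PosNum b0).
have [n [[[Fn Gn] Nn] bn]] := filter_ex (filterI (filterI (filterI nF nG) nN) nb).
(* The square lies above its tangent at [G x]. *)
have hG : G x ^+ 2 - s * (2 * G x) <= G (u n) ^+ 2.
  have := G_ge0 (u n); have := G_ge0 x; move: Gn => /=.
  by have [h|h] := leP (G x) (G (u n)); nra.
have hkG : k * G x ^+ 2 - b <= k * G (u n) ^+ 2.
  have := ler_wpM2l k0 hG; rewrite mulrBr => /(le_trans _); apply.
  rewrite lerB// mulrCA /s mulrAC ler_pdivrMr// ler_wpM2l ?ltW//.
  by rewrite ltrDl.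
have hN : eta * `|x - c| - b <= eta * `|u n - c|.
  have := ler_wpM2l eta0 (ltW Nn); rewrite mulrBr => /(le_trans _); apply.
  by rewrite lerB// /s' mulrCA ler_piMr ?ltW// ltr_pdivrMr// mul1r ltrDl.
have := uphi n; rewrite /phi; move: Fn bn => /=.
have : b * 5 = del by rewrite /b divfK.
move: n.+1%:R^-1 => q; lra.
Qed.

End Penalty.

(** * Stationarity of the penalized problem *)

(** Steps are taken from the right because an inequality will be divided by [s]. *)
Lemma directional_quotient_cvg (R : realType) (V W : normedModType R) (F : V -> W)
    (x h : V) : differentiable F x ->
  s^-1 *: (F (s *: h + x) - F x) @[s --> 0^'+] --> 'd F x h.
Proof.
move=> dF; rewrite -deriveE//.
exact/cvg_dnbhs_at_right/diff_derivable.
Qed.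

Section Stationarity.
Context {R : realType} {X Y : normedModType R}.
Context {d : measure_display} {T : measurableType d}.
Variables (mu : {measure set T -> \bar R}) (e : Y -> T -> R).
Variables (f : X -> R) (g : X -> Y).
Hypothesis he : dense_embedding mu e.
Variables (k eta rho : R) (x : X).
Hypotheses (k_ge0 : 0 <= k) (rho_gt0 : 0 < rho).
Hypotheses (df : differentiable f x) (dg : differentiable g x).

Let pen y := f y + k * L2norm mu (posp (e (g y))) ^+ 2.
Hypothesis x_min : forall y, `|y - x| < rho -> pen x - eta * `|y - x| <= pen y.

Let p := posp (e (g x)).

(** Apply [x_min] at [s *: h + x], bound the penalty by its one-sided expansion, divide by [s] and
    let [s] tend to [0] from the right. *)
Lemma penalized_directional_ge h :
  - (eta * `|h|) <= 'd f x h + 2 * k * embZ mu e p ('d g x h).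
Proof.
have hp : inL2 mu p by apply: inL2_posp; case: he.
have [pl pc] := embZ_lin_cont _ _ he _ hp.
have pZ (a : R) y : embZ mu e p (a *: y) = a * embZ mu e p y.
  by apply: lin_contZ.
have [C C0 hC] := embedding_bounded _ _ he.
have qf := directional_quotient_cvg _ _ _ f x h df.
have qg := directional_quotient_cvg _ _ _ g x h dg.
set Qf := (fun s : R => _) in qf.
set Qg := (fun s : R => _) in qg.
have s_cvg0 : s @[s --> 0^'+] --> (0 : R).
  by apply: cvg_at_right_filter; exact: cvg_id.
(* The last summand, multiplied by [s], is the bound [k * (C * (s * |Qg s|)) ^+ 2] on the quadratic
   remainder; it vanishes in the limit. *)
have lim : Qf s + 2 * k * embZ mu e p (Qg s)
      + k * C ^+ 2 * (s * (`|Qg s| * `|Qg s|))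
    @[s --> 0^'+] --> 'd f x h + 2 * k * embZ mu e p ('d g x h)
      + k * C ^+ 2 * (0 * (`|'d g x h| * `|'d g x h|)).
  apply: cvgD; first apply: cvgD => //.
    by apply: cvgM; [exact: cvg_cst|exact: (cvg_comp _ _ qg (pc _))].
  apply: cvgM; first exact: cvg_cst.
  by apply: cvgM => //; apply: cvgM; exact: cvg_norm.
rewrite mul0r mulr0 addr0 in lim.
apply: (cvgr_to_ge lim); near=> s.
have s0 : 0 < s by near: s; exact: nbhs_right_gt.
have sQf : f (s *: h + x) = f x + s * Qf s.
  by rewrite /Qf /= mulrA divff ?gt_eqF// mul1r [RHS]addrC subrK.
have sQg : g (s *: h + x) - g x = s *: Qg s.
  by rewrite /Qg /= scalerA divff ?gt_eqF// scale1r.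
have /x_min : `|s *: h + x - x| < rho.
  rewrite addrK normrZ gtr0_norm//.
  apply: (@le_lt_trans _ _ (s * (`|h| + 1))).
    by rewrite ler_wpM2l ?ltW// ltrDl.
  rewrite -ltr_pdivlMr ?ltr_wpDl//; near: s.
  by apply: nbhs_right_lt; rewrite divr_gt0// ltr_wpDl.
rewrite addrK normrZ gtr0_norm// /pen sQf => hmin.
have := penalty_upper_expansion _ _ he (g x) (g (s *: h + x)).
rewrite sQg pZ -/p => hexp.
have hsq : L2norm mu (e (s *: Qg s)) ^+ 2 <= (C * (s * `|Qg s|)) ^+ 2.
  rewrite ler_pXn2r ?nnegrE ?L2norm_ge0 ?mulr_ge0 ?(ltW s0)//.
  by have := hC (s *: Qg s); rewrite normrZ gtr0_norm.
rewrite -(ler_pM2l s0).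
have := ler_wpM2l k_ge0 (le_trans hexp (lerD (lexx _) hsq)).
rewrite -/p in hmin *; move: hmin; lra.
Unshelve. all: by end_near.
Qed.

(** The one-sided estimates at [h] and [- h] combine by linearity. *)
Lemma penalized_stationarity h :
  `|'d f x h + embZ mu e (fun t => 2 * k * p t) ('d g x h)| <= eta * `|h|.
Proof.
have hp : inL2 mu p by apply: inL2_posp; case: he.
have -> : embZ mu e (fun t => 2 * k * p t) ('d g x h) =
    2 * k * embZ mu e p ('d g x h).
  rewrite /embZ L2innerC L2innerZr//; last by case: he.
  by rewrite L2innerC.
have := penalized_directional_ge h; have := penalized_directional_ge (- h).
have pN y : embZ mu e p (- y) = - embZ mu e p y.
  by rewrite -scaleN1r (lin_contZ _ (-1) y (embZ_lin_cont _ _ he _ hp)) mulN1r.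
rewrite normrN !linearN/= pN ler_norml => h1 h2.
by apply/andP; split; lra.
Qed.

End Stationarity.

(** * Approximate KKT points and the AKKT sequence *)

(** This yields one member of the AKKT sequence, with [eta] controlling both the distance and the
    residual. *)
Lemma approximate_KKT_point (R : realType) (X Y : normedModType R)
    (d : measure_display) (T : measurableType d) (mu : {measure set T -> \bar R})
    (e : Y -> T -> R) (f : X -> R) (g : X -> Y) (xbar : X) (eta : R) :
  reflexive_space X -> dense_embedding mu e ->
  (forall x, differentiable f x) -> (forall x, differentiable g x) ->
  weakly_lsc f -> weakly_lsc (fun x : X => L2norm mu (posp (e (g x)))) ->
  local_solution mu e f g xbar -> 0 < eta ->
  exists (x : X) (z : T -> R), [/\ `|x - xbar| <= eta,
    inL2 mu z /\ in_KYplus mu e (embZ mu e z),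
    forall h, `|'d f x h + embZ mu e z ('d g x h)| <= eta * `|h| &
    L2inner mu z (negp (e (g x))) = 0].
Proof.
move=> refl he df dg f_lsc G_lsc [feas [r r0 xmin]] eta0.
have eL2 y : inL2 mu (e y) by case: he.
pose G x := L2norm mu (posp (e (g x))).
have G0 x : 0 <= G x by exact: L2norm_ge0.
have Gxbar : G xbar = 0 by apply/(Yle0P _ _ he).
(* The closed ball of radius [rr] lies in the open ball of local optimality. *)
pose rr := r / 2; have rr0 : 0 < rr by rewrite divr_gt0.
(* The bound [rr / 2] will put [x] in the interior of the ball, with room for variations of size
   [rr / 2]. *)
pose eta' := Num.min eta (rr / 2).
have eta'0 : 0 < eta' by rewrite lt_min eta0 divr_gt0.
have xbar_min y : `|y - xbar| <= rr -> G y = 0 -> f xbar <= f y.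
  move=> yr /(Yle0P _ _ he); apply: xmin; apply: le_lt_trans yr _.
  by rewrite /rr ltr_pdivrMr// ltr_pMr// ltr1n.
have [k k0 hk] := penalty_lower_bound f G xbar rr refl f_lsc G_lsc G0
  (eta' ^+ 2) (exprn_gt0 _ eta'0) xbar_min.
have [x xr hx] := penalized_minimizer f G xbar rr refl f_lsc G_lsc G0
  k eta' _ (ltW rr0) k0 (ltW eta'0) hk.
(* Comparison with [xbar] gives [f xbar - eta' ^+ 2 + eta' * |x - xbar| <= f xbar]. *)
have xeta : `|x - xbar| <= eta'.
  have := hx xbar; rewrite subrr normr0 Gxbar expr0n/= !mulr0 !addr0.
  move=> /(_ (ltW rr0)).
  have := hk _ xr => h1 h2.
  by rewrite -(ler_pM2l eta'0) -expr2; lra.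
have etaE : eta' <= eta by rewrite ge_min lexx.
have hp : inL2 mu (posp (e (g x))) by exact: inL2_posp.
have hz : inL2 mu (fun t => 2 * k * posp (e (g x)) t) by exact: inL2Z.
exists x, (fun t => 2 * k * posp (e (g x)) t); split.
- exact: le_trans etaE.
- split=> //; apply: embZ_in_KYplus => // t.
  by rewrite !mulr_ge0// le_max lexx orbT.
- move=> h; apply: (@le_trans _ _ (eta' * `|h|)); last by rewrite ler_wpM2r.
  apply: (penalized_stationarity mu e f g he k eta' (rr / 2)) => //.
    by rewrite divr_gt0.
  move=> y yx.
  have xr2 : `|x - xbar| <= rr / 2 by rewrite (le_trans xeta)// ge_min lexx orbT.
  (* This keeps [y] in the ball and also replaces the difference of the distance terms by
     [eta' * |y - x|]. *)
  have ytri : `|y - xbar| <= `|y - x| + `|x - xbar|.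
    by rewrite -[y - xbar](subrKA x) ler_normD.
  have := hx y; rewrite (le_trans ytri); last by lra.
  move=> /(_ isT); have := ler_wpM2l (ltW eta'0) ytri.
  by rewrite -/(G x) -/(G y); lra.
- exact: L2inner_posp_negp.
Qed.

Theorem theorem5p3 (R : realType) (X Y : completeNormedModType R)
    (d : measure_display) (T : measurableType d) (mu : {measure set T -> \bar R})
    (e : Y -> T -> R) (f : X -> R) (g : X -> Y) (xbar : X) :
  reflexive_space X ->
  dense_embedding mu e ->
  C1 f -> C1 g ->
  weakly_lsc f ->
  weakly_lsc (fun x : X => L2norm mu (posp (e (g x)))) ->
  local_solution mu e f g xbar ->
  AKKT mu e f g xbar.
Proof.
move=> refl he [df _] [dg _] f_lsc G_lsc sol.
have eta0 (n : nat) : 0 < n.+1%:R^-1 :> R by rewrite invr_gt0.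
have KKT n := approximate_KKT_point _ _ _ _ _ _ _ _ _ _ _
  refl he df dg f_lsc G_lsc sol (eta0 n).
have [xs /choice[zs H]] := choice KKT.
exists xs, zs; split; [|split; [|split]].
- apply/cvgrPdist_le => eps eps0; near=> n.
  have [h _ _ _] := H n; rewrite distrC (le_trans h)// ltW//.
  by near: n; exact: near_infty_natSinv_lt (PosNum eps0).
- by move=> n; have [] := H n.
- move=> eps eps0; near=> n => h.
  have [_ _ /(_ h) hn _] := H n; rewrite (le_trans hn)// ler_wpM2r// ltW//.
  by near: n; exact: near_infty_natSinv_lt (PosNum eps0).
(* Complementarity is exact at each index, so this sequence is constantly [0]. *)
- rewrite (_ : (fun n => _) = cst 0); first exact: cvg_cst.
  by apply/funext => n; have [] := H n.
Unshelve. all: by end_near.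
Qed.
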